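(* Let $X$ be a real Hilbert space. Let $A\colon X\rightrightarrows X$ be maximally monotone, let $(x,u)\in X\times X$, and let $C$ and $D$ be closed affine subspaces of $X$ such that $D-D=(C-C)^\perp$. Furthermore, let $(x_n,u_n)_{n\in\mathbb{N}}$ be a sequence in $\operatorname{gra} A$ such that $$(x_n,u_n)\rightharpoonup (x,u)\quad\text{and}\quad (x_n,u_n)-P_{C\times D}(x_n,u_n)\to (0,0).$$ Then $(x,u)\in (C\times D)\cap \operatorname{gra} A$ and $\langle x_n,u_n\rangle\to\langle x,u\rangle$.
   Context: $X$ is a real Hilbert space with inner product $\langle\cdot,\cdot\rangle$ and induced norm $\|\cdot\|$; $X\times X$ carries the product Hilbert space structure. $\rightharpoonup$ denotes weak convergence and $\to$ denotes norm (strong) convergence. A set-valued operator $A\colon X\rightrightarrows X$ has graph $\operatorname{gra}A=\{(x,u)\in X\times X \mid u\in Ax\}$; it is monotone if $\langle x-y,u-v\rangle\ge 0$ for all $(x,u),(y,v)\in\operatorname{gra}A$, and maximally monotone if it is monotone and its graph is not properly contained in the graph of another monotone operator. Affine subspaces are understood to be nonempty. For an affine subspace $C$, $C-C=\{c-c'\mid c,c'\in C\}$ is the linear subspace parallel to $C$, and $\perp$ denotes orthogonal complement. For a nonempty closed convex set $S$, $P_S$ is the projector (nearest point mapping) onto $S$; in particular $P_{C\times D}(x,u)=(P_Cx,P_Du)$. *)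

(* Defs.v *)
From HB Require Import structures.
From mathcomp Require Import all_boot all_order all_algebra.
From mathcomp Require Import boolp classical_sets reals topology normedtype sequences.

Set Implicit Arguments.
Unset Strict Implicit.
Unset Printing Implicit Defensive.

Import Order.TTheory GRing.Theory Num.Theory.
Import numFieldNormedType.Exports.

Local Open Scope classical_set_scope.
Local Open Scope ring_scope.

(* Real inner products. A real Hilbert space is a completeNormedModType whose
   norm is the one induced by such an inner product. *)
Notation "{ 'inner' U }" := {dot U for idfun} (format "{ 'inner'  U }").

(* The library norm on a product of normed modules is the sup norm, which does
   not come from an inner product. The metric notions below are therefore
   parametrised by an inner product, so that they apply to the product Hilbert
   structure on X * X. *)
Section ProductInner.
Variables (R : realType) (U V : lmodType R) (f : {inner U}) (g : {inner V}).

Definition prod_inner (z w : U * V) : R := f z.1 w.1 + g z.2 w.2.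

Fact prod_inner_linearl w :
  GRing.linear_for ( *%R : R -> R -> R) (prod_inner ^~ w).
Proof.
by move=> a z z'; rewrite /prod_inner /= !linearPl /= mulrDr addrACA.
Qed.

Fact prod_inner_linearr z :
  GRing.linear_for (@idfun R \; *%R) (prod_inner z).
Proof.
by move=> a w w'; rewrite /prod_inner /= !linearPr /= mulrDr addrACA.
Qed.

HB.instance Definition _ := @bilinear_isBilinear.Build R (U * V)%type
  (U * V)%type R *%R (@idfun R \; *%R) prod_inner
  (prod_inner_linearl, prod_inner_linearr).

Fact prod_inner_sym z w :
  prod_inner z w = (-1) ^+ false * @idfun R (prod_inner w z).
Proof.
by rewrite /prod_inner (hermC f) (hermC g) !mul1r.
Qed.

HB.instance Definition _ := @isHermitianSesquilinear.Build R (U * V)%type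
  false (@idfun R) prod_inner prod_inner_sym.

Fact prod_inner_gt0 z : z != 0 -> 0 < prod_inner z z.
Proof.
have ge0 (W : lmodType R) (h : {inner W}) w : 0 <= h w w.
  by have [->|/(neq0_dnorm_gt0 (s := h))/ltW//] := eqVneq w 0; rewrite linear0r.
case: z => u v nz; rewrite /prod_inner /=.
have [u0|u0] := eqVneq u 0.
  apply: ltr_wpDl => //; apply: neq0_dnorm_gt0.
  by apply: contra nz => /eqP ->; rewrite u0.
by apply: ltr_wpDr => //; exact: neq0_dnorm_gt0.
Qed.

HB.instance Definition _ := @isDotProduct.Build R (U * V)%type
  prod_inner prod_inner_gt0.

End ProductInner.

Section InnerNotions.
Variables (R : realType) (E : lmodType R) (ip : {inner E}).

Definition inorm (x : E) : R := Num.sqrt (ip x x).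

Definition strong_cvg (x_ : nat -> E) (x : E) : Prop :=
  (fun n => inorm (x_ n - x)) @ \oo --> (0 : R).

Definition weak_cvg (x_ : nat -> E) (x : E) : Prop :=
  forall y : E, (fun n => ip (x_ n) y) @ \oo --> ip x y.

Definition orthocompl (S : set E) : set E :=
  [set v | forall s, S s -> ip v s = 0].

Definition nearest_point (S : set E) (x p : E) : Prop :=
  S p /\ forall q, S q -> inorm (x - p) <= inorm (x - q).

(* The nearest point exists and is unique when E is complete and S is nonempty,
   closed and convex; the default value x is irrelevant then. *)
Definition projector (S : set E) (x : E) : E := xget x (nearest_point S x).

Definition graph (A : E -> set E) : set (E * E) := [set z | A z.1 z.2].

Definition monotone_op (A : E -> set E) : Prop :=
  forall x u y v, graph A (x, u) -> graph A (y, v) -> 0 <= ip (x - y) (u - v).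

Definition maximally_monotone (A : E -> set E) : Prop :=
  monotone_op A /\
  ~ exists2 B : E -> set E, monotone_op B & graph A `<` graph B.

End InnerNotions.

Section Affine.
Variables (R : realType) (E : lmodType R).

Definition affine_subspace (C : set E) : Prop :=
  C !=set0 /\
  forall (a : R) (x y : E), C x -> C y -> C (a *: x + (1 - a) *: y).

Definition set_sub (C D : set E) : set E := [set c - d | c in C & d in D].

End Affine.

(* Main.v *)
Require Import Defs.
From mathcomp Require Import all_boot all_order all_algebra.
From mathcomp Require Import boolp classical_sets reals topology normedtype sequences.
From mathcomp Require Import ring lra.
Import Order.TTheory GRing.Theory Num.Theory.
Import numFieldNormedType.Exports.
Local Open Scope classical_set_scope.
Local Open Scope ring_scope.

(* Let (p_n, q_n) be the projections of (x_n, u_n) onto C * D; they converge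
   weakly to (x, u), and closed affine sets are weakly closed, so (x, u) lies in
   C * D. Since p_n - x and q_n - u are orthogonal, <x_n - x, u_n - u> only
   contains products of a weakly convergent, hence bounded, sequence with one of
   the vanishing sequences x_n - p_n, u_n - q_n, so it tends to 0, and
   <x_n, u_n> tends to <x, u>. Passing to the limit in the monotonicity
   inequality between (x_n, u_n) and an arbitrary point of the graph of A shows
   that (x, u) is monotonically related to the graph, hence belongs to it by
   maximality. *)

(** * Inner product inequalities and orthogonality at a nearest point *)

Section InnerProduct.
Context {R : realType} {E : lmodType R} (ip : {inner E}).
Implicit Types (C S : set E) (x y z p : E).

Lemma inner_sym x y : ip x y = ip y x.
Proof. by rewrite (hermC ip) mul1r. Qed.

Lemma inner_ge0 x : 0 <= ip x x.
Proof.
by have [->|/(neq0_dnorm_gt0 (s := ip))/ltW//] := eqVneq x 0; rewrite linear0r.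
Qed.

Lemma inner_eq0 x : ip x x = 0 -> x = 0.
Proof.
have [//|/(neq0_dnorm_gt0 (s := ip))] := eqVneq x 0.
by move=> /[swap] ->; rewrite ltxx.
Qed.

Lemma inner_sqrB x y : ip (x - y) (x - y) = ip x x - 2 * ip x y + ip y y.
Proof. rewrite !linearBl !linearBr /= (inner_sym y x); ring. Qed.

Lemma sqr_inorm x : inorm ip x ^+ 2 = ip x x.
Proof. by rewrite sqr_sqrtr// inner_ge0. Qed.

Lemma inorm_ge0 x : 0 <= inorm ip x.
Proof. exact: sqrtr_ge0. Qed.

Lemma inner_cauchy_schwarz x y : `|ip x y| <= inorm ip x * inorm ip y.
Proof.
rewrite -ler_sqr ?nnegrE ?mulr_ge0 ?inorm_ge0// exprMn !sqr_inorm real_normK ?num_real//.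
have [->|/(neq0_dnorm_gt0 (s := ip)) y_gt0] := eqVneq y 0.
  by rewrite !linear0r expr0n mulr0.
(* This vector is [ip y y] times the component of x orthogonal to y. *)
have := inner_ge0 (ip y y *: x - ip x y *: y).
rewrite inner_sqrB !linearZr_LR/= !linearZl_LR/=.
have -> : ip y y * (ip y y * ip x x) - 2 * (ip x y * (ip y y * ip x y))
    + ip x y * (ip x y * ip y y) = ip y y * (ip x x * ip y y - ip x y ^+ 2) by ring.
by rewrite pmulr_rge0// subr_ge0.
Qed.

Lemma parallelogram x c d :
  ip (c - d) (c - d) = 2 * ip (x - c) (x - c) + 2 * ip (x - d) (x - d)
    - 4 * ip (x - 2^-1 *: (c + d)) (x - 2^-1 *: (c + d)).
Proof.
rewrite !inner_sqrB !linearZr_LR !linearZl_LR !linearDr !linearDl /=.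
rewrite (inner_sym d c); lra.
Qed.

Lemma nearest_pointP S x p :
  nearest_point ip S x p <->
  S p /\ forall q, S q -> ip (x - p) (x - p) <= ip (x - q) (x - q).
Proof.
by split=> -[Sp min_p]; split=> // q /min_p; rewrite ler_sqrt ?inner_ge0.
Qed.

(** The whole line through p and c lies in C, so t may take either sign. The quadratic
    [t ^+ 2 * b - 2 * t * k] is then nonnegative for every real t, which forces its linear
    coefficient to vanish. *)
Lemma nearest_point_orthogonal C x p c :
  affine_subspace C -> nearest_point ip C x p -> C c -> ip (x - p) (c - p) = 0.
Proof.
move=> [_ affC] /nearest_pointP[Cp min_p] Cc.
set k := ip _ _; set b := ip (c - p) (c - p).
have b_ge0 : 0 <= b := inner_ge0 _.
have key t : 0 <= t ^+ 2 * b - 2 * t * k.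
  have := min_p _ (affC t _ _ Cc Cp).
  have -> : x - (t *: c + (1 - t) *: p) = (x - p) - t *: (c - p).
    by rewrite scalerBl scale1r scalerBr addrCA opprD addrA.
  rewrite (inner_sqrB (x - p)) linearZr_LR/= linearZl_LR linearZr_LR/= -/k -/b.
  by move=> ?; nra.
(* Dividing by b + 1 instead of taking the minimiser k / b also covers c = p, where b = 0. *)
have := key (k / (b + 1)).
have -> : (k / (b + 1)) ^+ 2 * b - 2 * (k / (b + 1)) * k =
  - (k ^+ 2 * ((b + 2) / (b + 1) ^+ 2)) by field; lra.
rewrite oppr_ge0 pmulr_lle0; last by rewrite divr_gt0 ?exprn_gt0; lra.
by move=> k2; apply/eqP; rewrite -sqrf_eq0 eq_le k2 sqr_ge0.
Qed.

End InnerProduct.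

Lemma affine_midpoint {R : realType} {E : lmodType R} (C : set E) c d :
  affine_subspace C -> C c -> C d -> C (2^-1 *: (c + d)).
Proof.
move=> [_ affC] Cc Cd.
rewrite (_ : _ *: _ = 2^-1 *: c + (1 - 2^-1) *: d); first exact: affC.
by rewrite scalerDr; congr (_ + _ *: _); field.
Qed.

(** * Nearest points and weak convergence in a Hilbert space *)

Section Hilbert.
Context {R : realType} {X : completeNormedModType R} {ip : {inner X}}.
Hypothesis norm_ip : forall z : X, `|z| = inorm ip z.
Implicit Types (C : set X) (x : X).

Lemma sqr_norm_inner x : `|x| ^+ 2 = ip x x.
Proof. by rewrite norm_ip sqr_inorm. Qed.

Lemma inner_norm_le x y : `|ip x y| <= `|x| * `|y|.
Proof. by rewrite !norm_ip inner_cauchy_schwarz. Qed.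

(** A minimising sequence is Cauchy by the parallelogram law, which involves midpoints only; its
    limit stays in C and attains the infimum by continuity of the norm. *)
Lemma nearest_point_exists C x : C !=set0 -> closed C ->
    (forall c d, C c -> C d -> C (2^-1 *: (c + d))) ->
  exists p, nearest_point ip C x p.
Proof.
move=> [c0 Cc0] closedC midC.
pose D := [set ip (x - c) (x - c) | c in C].
have lbD : has_lbound D by exists 0 => _ [c _ <-]; exact: inner_ge0.
have infD : has_inf D by split=> //; exists (ip (x - c0) (x - c0)), c0.
have inf_le c : C c -> inf D <= ip (x - c) (x - c).
  by move=> Cc; apply: ge_inf => //; exists c.
have /choice[c_ Hc] (n : nat) :
    exists c, C c /\ ip (x - c) (x - c) < inf D + n.+1%:R^-1.
  have [|_ [c Cc <-] lt_c] := @inf_adherent _ D n.+1%:R^-1 _ infD.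
    by rewrite invr_gt0.
  by exists c.
(* The midpoint has squared distance at least [inf D], so the four copies of the infimum cancel and
   only the two errors remain. *)
have dist_le n m :
    ip (c_ n - c_ m) (c_ n - c_ m) <= 2 * (n.+1%:R^-1 + m.+1%:R^-1).
  have [Cn ltn] := Hc n; have [Cm ltm] := Hc m.
  have := inf_le _ (midC _ _ Cn Cm).
  rewrite (parallelogram ip x (c_ n)).
  by move: (n.+1%:R^-1) (m.+1%:R^-1) ltn ltm => a b ? ? ?; lra.
have /cauchy_cvg/cvg_ex[p c_p] : cauchy (c_ @ \oo).
  apply/cauchy_ballP => e e0; near_simpl.
  have small : \forall n \near \oo, n.+1%:R^-1 < e ^+ 2 / 4 :> R.
    by apply: (cvgr_lt _ cvg_harmonic); rewrite divr_gt0 ?exprn_gt0.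
  near=> m n => /=.
  rewrite -ball_normE/=.
  rewrite -ltr_sqr ?nnegrE ?(ltW e0)// sqr_norm_inner.
  apply: le_lt_trans (dist_le _ _) _.
  have mS : m.+1%:R^-1 < e ^+ 2 / 4 by near: m; exact: small.
  have nS : n.+1%:R^-1 < e ^+ 2 / 4 by near: n; exact: small.
  by move: (m.+1%:R^-1) (n.+1%:R^-1) mS nS => a b ? ?; lra.
exists p; apply/nearest_pointP; split.
  by apply: (closed_cvg _ closedC) c_p; apply: nearW => n; have [] := Hc n.
move=> q /inf_le; apply: le_trans; rewrite -sqr_norm_inner.
have dist_p : (fun n => `|x - c_ n| ^+ 2) @ \oo --> `|x - p| ^+ 2.
  have cn : (fun n => `|x - c_ n|) @ \oo --> `|x - p|.
    by apply: cvg_norm; apply: cvgB => //; exact: cvg_cst.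
  exact: (cvgM cn cn).
have bound_inf : (fun n => inf D + n.+1%:R^-1) @ \oo --> inf D.
  by rewrite -[X in _ --> X]addr0; apply: cvgD; [exact: cvg_cst|exact: cvg_harmonic].
apply: (ler_cvg_to dist_p bound_inf); apply: nearW => n.
by rewrite sqr_norm_inner ltW; have [] := Hc n.
Unshelve. all: by end_near. Qed.

(** If p is nearest to x in C, then pairing with x - p is constant on C. The weak limit x inherits
    this constant, so x - p is orthogonal to itself. *)
Lemma weak_cvg_affine C (c_ : nat -> X) x : affine_subspace C -> closed C ->
  (forall n, C (c_ n)) -> weak_cvg ip c_ x -> C x.
Proof.
move=> affC closedC Cc wc.
have [p Np] : exists p, nearest_point ip C x p.
  have [C0 _] := affC.
  by apply: nearest_point_exists => // c d; exact: affine_midpoint.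
have [Cp _] := Np.
suff : ip (x - p) (x - p) = 0 by move=> /inner_eq0/subr0_eq ->.
have wcp := wc (x - p).
have : (fun n => ip (c_ n) (x - p)) @ \oo --> ip p (x - p).
  rewrite (_ : (fun _ => _) = fun=> ip p (x - p)); first exact: cvg_cst.
  apply/funext => n /=; apply/subr0_eq; rewrite -linearBl/= inner_sym.
  exact: (nearest_point_orthogonal _ _ _ _ _ affC Np (Cc n)).
move=> /(cvg_unique _ wcp) eq_ip; rewrite linearBl/= eq_ip ?subrr//.
Qed.

(** The functionals [ip (x_ n)] are pointwise bounded, since convergent real sequences are; the
    uniform boundedness principle then bounds them on the unit ball. *)
Lemma weak_cvg_bounded (x_ : nat -> X) x :
  weak_cvg ip x_ x -> exists M, forall n, `|x_ n| <= M.
Proof.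
move=> wx.
pose F : set (X -> R^o) := [set (fun y => ip (x_ n) y : R^o) | n in setT].
have [||M HM] := @Banach_Steinhauss _ X R^o F _ _ 1.
- move=> _ [n _ <-]; split.
    move=> r; exists (`|x_ n| * r) => y yr.
    by rewrite (le_trans (inner_norm_le _ _))// ler_wpM2l.
  move=> a y z; exact: linearPr.
- move=> y; have /cvgP/cvg_seq_bounded/pinfty_ex_gt0[M _ HM] := wx y.
  by exists M => _ [n _ <-]; exact: HM.
exists M => n.
have Fn : F (fun y => ip (x_ n) y) by exists n.
have [x0|x0] := eqVneq `|x_ n| 0.
  by rewrite x0 (le_trans _ (HM _ Fn 0 _))// normr0.
(* At its own normalised vector the functional takes the value [|x_ n|]. *)
have := HM _ Fn (`|x_ n|^-1 *: x_ n).
rewrite normrZ normfV normr_id mulVf// => /(_ (lexx _)).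
rewrite linearZr_LR/= -sqr_norm_inner expr2 mulKf//.
by rewrite normr_id.
Qed.

Lemma inner_bounded_cvg0 (a_ b_ : nat -> X) :
    (exists M, forall n, `|a_ n| <= M) -> (fun n => `|b_ n|) @ \oo --> (0 : R) ->
  (fun n => ip (a_ n) (b_ n)) @ \oo --> (0 : R).
Proof.
move=> [M aM] b0; apply/(@norm_cvg0P _ R).
have Mb0 : (fun n => M * `|b_ n|) @ \oo --> (0 : R).
  by rewrite -(mulr0 M); apply: cvgM => //; exact: cvg_cst.
apply: (squeeze_cvgr _ (cvg_cst 0) Mb0); apply: nearW => n.
by rewrite normr_ge0 (le_trans (inner_norm_le _ _))// ler_wpM2r.
Qed.

Lemma weak_cvg_strong_sub (x_ p_ : nat -> X) x :
    weak_cvg ip x_ x -> (fun n => `|x_ n - p_ n|) @ \oo --> (0 : R) ->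
  weak_cvg ip p_ x.
Proof.
move=> wx xp0 y.
have -> : (fun n => ip (p_ n) y) = (fun n => ip (x_ n) y - ip y (x_ n - p_ n)).
  by apply/funext => n; rewrite (inner_sym ip y) linearBl/= subKr.
rewrite -[X in _ --> X]subr0; apply: cvgB; first exact: wx.
by apply: inner_bounded_cvg0 => //; exists `|y|.
Qed.

(** Expanding around the limits leaves, besides the centred product, only terms with at most one
    varying factor, and weak convergence handles those. *)
Lemma cvg_inner_weak (x_ u_ : nat -> X) x u :
    weak_cvg ip x_ x -> weak_cvg ip u_ u ->
    (fun n => ip (x_ n - x) (u_ n - u)) @ \oo --> (0 : R) ->
  (fun n => ip (x_ n) (u_ n)) @ \oo --> ip x u.
Proof.
move=> wx wu xu0.
have -> : (fun n => ip (x_ n) (u_ n)) =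
    (fun n => ip (x_ n - x) (u_ n - u) + (ip (u_ n) x + ip (x_ n) u - ip x u)).
  apply/funext => n; rewrite !linearBl !linearBr/= (inner_sym ip (u_ n)); ring.
rewrite [X in _ --> X](_ : _ = 0 + (ip u x + ip x u - ip x u)); last first.
  by rewrite (inner_sym ip u); ring.
apply: cvgD => //; apply: cvgB; last exact: cvg_cst.
by apply: cvgD; [exact: wu|exact: wx].
Qed.

End Hilbert.

(** * Passing between the product Hilbert space and its factors *)

Section ProductSpace.
Context {R : realType} {E F : lmodType R} (f : {inner E}) (g : {inner F}).

Lemma inorm_fst_le z : inorm f z.1 <= inorm (prod_inner f g) z.
Proof. by rewrite ler_wsqrtr// lerDl inner_ge0. Qed.

Lemma inorm_snd_le z : inorm g z.2 <= inorm (prod_inner f g) z.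
Proof. by rewrite ler_wsqrtr// lerDr inner_ge0. Qed.

Lemma weak_cvg_fst (z_ : nat -> E * F) z :
  weak_cvg (prod_inner f g) z_ z -> weak_cvg f (fun n => (z_ n).1) z.1.
Proof.
move=> wz y; have innerE w : prod_inner f g w (y, 0) = f w.1 y.
  by rewrite /prod_inner/= linear0r addr0.
by have := wz (y, 0); rewrite /= innerE; under eq_fun do rewrite /= innerE.
Qed.

Lemma weak_cvg_snd (z_ : nat -> E * F) z :
  weak_cvg (prod_inner f g) z_ z -> weak_cvg g (fun n => (z_ n).2) z.2.
Proof.
move=> wz y; have innerE w : prod_inner f g w (0, y) = g w.2 y.
  by rewrite /prod_inner/= linear0r add0r.
by have := wz (0, y); rewrite /= innerE; under eq_fun do rewrite /= innerE.
Qed.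

Lemma nearest_point_setX (C : set E) (D : set F) x p u q :
    nearest_point f C x p -> nearest_point g D u q ->
  nearest_point (prod_inner f g) (C `*` D) (x, u) (p, q).
Proof.
move=> /nearest_pointP[Cp min_p] /nearest_pointP[Dq min_q].
apply/nearest_pointP; split=> // -[c d] [/= Cc Dd].
by rewrite /prod_inner/= lerD ?min_p ?min_q.
Qed.

End ProductSpace.

(** * Maximality and passage to the limit in the graph *)

Lemma maximally_monotone_mem {R : realType} {E : lmodType R} (ip : {inner E})
    (A : E -> set E) x u :
    maximally_monotone ip A ->
    (forall y v, graph A (y, v) -> 0 <= ip (x - y) (u - v)) ->
  graph A (x, u).
Proof.
move=> [monA maxA] xu_mon; apply: contrapT => nAxu; apply: maxA.
(* Adjoining a missing but monotonically related pair would give a strictly larger monotone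
   graph. *)
exists (fun y => [set v | A y v \/ (y, v) = (x, u)]); last first.
  split; first by move=> [y v] Ayv; left.
  by move=> /(_ (x, u)) sub; apply: nAxu; apply: sub; right.
move=> y v z w [Ayv|[-> ->]] [Azw|[-> ->]].
- exact: monA.
- by rewrite -(opprB x y) -(opprB u v) linearNl linearNr opprK; exact: xu_mon.
- exact: xu_mon.
- by rewrite subrr linear0l.
Qed.

Theorem theorem2p2 (R : realType) (X : completeNormedModType R)
    (ip : {inner X}) (norm_ip : forall z : X, `|z| = inorm ip z)
    (A : X -> set X) (maxA : maximally_monotone ip A)
    (x u : X) (C D : set X)
    (affC : affine_subspace C) (closedC : closed C)
    (affD : affine_subspace D) (closedD : closed D)
    (parCD : set_sub D D = orthocompl ip (set_sub C C))
    (x_ u_ : nat -> X)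
    (graA : forall n, graph A (x_ n, u_ n))
    (weak_xu : weak_cvg (prod_inner ip ip) (fun n => (x_ n, u_ n)) (x, u))
    (strong_xu : strong_cvg (prod_inner ip ip)
       (fun n => (x_ n, u_ n)
                 - projector (prod_inner ip ip) (C `*` D) (x_ n, u_ n))
       (0, 0)) :
  ((C `*` D) `&` graph A) (x, u) /\
  (fun n => ip (x_ n) (u_ n)) @ \oo --> ip x u.
Proof.
have /= wx := weak_cvg_fst _ _ _ _ weak_xu.
have /= wu := weak_cvg_snd _ _ _ _ weak_xu.
pose p_ n := (projector (prod_inner ip ip) (C `*` D) (x_ n, u_ n)).1.
pose q_ n := (projector (prod_inner ip ip) (C `*` D) (x_ n, u_ n)).2.
have nearest_affine S y : affine_subspace S -> closed S ->
    exists p, nearest_point ip S y p.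
  move=> affS closedS; have [S0 _] := affS.
  by apply: nearest_point_exists => // c d; exact: affine_midpoint.
(* Exhibiting a nearest point in the product rules out the default value of [projector], so its
   value does lie in [C]*[D]. *)
have CDpq n : C (p_ n) /\ D (q_ n).
  have [p Np] := nearest_affine C (x_ n) affC closedC.
  have [q Nq] := nearest_affine D (u_ n) affD closedD.
  have /(xgetPex (x_ n, u_ n))[[? ?] _] :
      exists z, nearest_point (prod_inner ip ip) (C `*` D) (x_ n, u_ n) z.
    by exists (p, q); exact: nearest_point_setX.
  by [].
have xp0 : (fun n => `|x_ n - p_ n|) @ \oo --> (0 : R).
  apply: (squeeze_cvgr _ (cvg_cst 0) strong_xu); apply: nearW => n.
  rewrite normr_ge0 norm_ip/=.
  by have := inorm_fst_le ip ip ((x_ n, u_ n) - (p_ n, q_ n)); rewrite subr0.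
have uq0 : (fun n => `|u_ n - q_ n|) @ \oo --> (0 : R).
  apply: (squeeze_cvgr _ (cvg_cst 0) strong_xu); apply: nearW => n.
  rewrite normr_ge0 norm_ip/=.
  by have := inorm_snd_le ip ip ((x_ n, u_ n) - (p_ n, q_ n)); rewrite subr0.
have wp := weak_cvg_strong_sub norm_ip _ _ _ wx xp0.
have wq := weak_cvg_strong_sub norm_ip _ _ _ wu uq0.
have Cx : C x by apply: (weak_cvg_affine norm_ip _ _ _ affC _ _ wp) => // n; have [] := CDpq n.
have Du : D u by apply: (weak_cvg_affine norm_ip _ _ _ affD _ _ wq) => // n; have [] := CDpq n.
(* As x and u are already known to lie in C and D, these differences are directions of C and D. *)
have orth n : ip (p_ n - x) (q_ n - u) = 0.
  have [Cp Dq] := CDpq n.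
  have : set_sub D D (q_ n - u) by exists (q_ n) => //; exists u.
  rewrite parCD inner_sym; apply.
  by exists (p_ n) => //; exists x.
have bounded_sub (a_ : nat -> X) a : weak_cvg ip a_ a ->
    exists M, forall n, `|a_ n - a| <= M.
  move=> /(weak_cvg_bounded norm_ip _ _)[M aM]; exists (M + `|a|) => n.
  by rewrite (le_trans (ler_normB _ _))// lerD2r.
have xu0 : (fun n => ip (x_ n - x) (u_ n - u)) @ \oo --> (0 : R).
  (* Splitting both factors at p_n and q_n gives these two terms plus the product that [orth] kills;
     each has one bounded and one vanishing factor. *)
  have -> : (fun n => ip (x_ n - x) (u_ n - u)) =
      (fun n => ip (p_ n - x) (u_ n - q_ n) + ip (u_ n - u) (x_ n - p_ n)).
    apply/funext => n; apply/subr0_eq; rewrite -(orth n).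
    rewrite (inner_sym ip (u_ n - u)) !linearBl !linearBr /=; ring.
  rewrite -[X in _ --> X]addr0; apply: cvgD.
    by apply: (inner_bounded_cvg0 norm_ip _ _ _ uq0); exact: (bounded_sub _ _ wp).
  by apply: (inner_bounded_cvg0 norm_ip _ _ _ xp0); exact: (bounded_sub _ _ wu).
have ip_lim := cvg_inner_weak _ _ _ _ wx wu xu0.
split=> //; split=> //.
apply: (maximally_monotone_mem _ _ _ _ maxA) => y v Ayv.
have monA := maxA.1.
have lim : (fun n => ip (x_ n - y) (u_ n - v)) @ \oo --> ip (x - y) (u - v).
  have wv z_ (z w : X) : weak_cvg ip z_ z -> weak_cvg ip (fun n => z_ n - w) (z - w).
    move=> wz t; rewrite linearBl/=; under eq_fun do rewrite linearBl/=.
    by apply: cvgB; [exact: wz|exact: cvg_cst].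
  (* Translating by y and v leaves the centred product unchanged, so [xu0] applies again. *)
  apply: cvg_inner_weak; [exact: wv|exact: wv|].
  under eq_fun do rewrite !opprB !addrA !subrK.
  exact: xu0.
by apply: (ler_cvg_to (cvg_cst 0) lim); apply: nearW => n; exact: monA.
Qed.
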